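(* Let $F_2$ be the free group of rank $2$. The action of $F_2$ on the Higson corona $\nu F_2$ induced by the left-translation action $F_2\times F_2\to F_2$, $(g,h)\mapsto gh$, does not have any fixed point. That is, there is no point $x\in\nu F_2$ such that $g\cdot x=x$ for every $g\in F_2$.
   Context: $F_2$ carries the discrete topology, a left-invariant word metric $d$ for a finite generating set, and the associated bounded coarse structure ($E\subset F_2\times F_2$ is controlled if $\sup_{(x,y)\in E}d(x,y)<\infty$; bounded sets are the finite sets). For $f\colon F_2\to\mathbb{C}$ put $\mathbf{d}f(x,y)=f(y)-f(x)$. A bounded function $f$ is a Higson function if for every controlled set $E$ and every $\epsilon>0$ there is a bounded (finite) set $B$ with $|\mathbf{d}f(x,y)|<\epsilon$ for all $(x,y)\in E\setminus(B\times B)$. The Higson functions form a unital $C^*$-algebra $C_h(F_2)$; the Higson compactification $hF_2$ is the compactification of $F_2$ with $C(hF_2)=C_h(F_2)$, and the Higson corona is $\nu F_2=hF_2\setminus F_2$. For $g\in F_2$, the left translation $\Psi_g\colon h\mapsto gh$ is an isometry, hence a coarse map, and pullback $\phi\mapsto\phi\circ\Psi_g$ on $C_h(F_2)$ induces a continuous map ${}_\nu\Psi_g\colon\nu F_2\to\nu F_2$; the induced action is $g\cdot x={}_\nu\Psi_g(x)$. *)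

(* Defs.v *)
From HB Require Import structures.
From mathcomp Require Import all_boot all_order all_algebra.
From mathcomp Require Import complex.
From mathcomp Require Import boolp classical_sets functions cardinality.
From mathcomp Require Import reals topology normedtype.

Set Implicit Arguments.
Unset Strict Implicit.
Unset Printing Implicit Defensive.

Import Order.TTheory GRing.Theory Num.Theory.
Import numFieldNormedType.Exports.

Local Open Scope classical_set_scope.
Local Open Scope ring_scope.

(** Free groups, as reduced words. The letter [(x, false)] stands for the
    generator [x] and [(x, true)] for its inverse. *)

Section ReducedWords.
Context {X : choiceType}.
Local Notation letter := (X * bool)%type.
Implicit Types (a b : letter) (u v w : seq letter).

Definition letter_inv a : letter := (a.1, ~~ a.2).

Definition reduced w := sorted [rel a b | b != letter_inv a] w.

Definition push a w :=
  if w is b :: w' then if b == letter_inv a then w' else a :: w else [:: a].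

Definition reduce w := foldr push [::] w.

Lemma letter_invK : involutive letter_inv.
Proof. by case=> x e; rewrite /letter_inv /= negbK. Qed.

Lemma push_reduced a w : reduced w -> reduced (push a w).
Proof.
case: w => [|b w] //= rw; case: ifPn => [_|ba]; last by rewrite /= ba.
by move: rw; case: w => //= c w /andP[].
Qed.

Lemma reduced_behead a w : reduced (a :: w) -> reduced w.
Proof. by case: w => //= b w /andP[]. Qed.

Lemma foldr_push_reduced u v : reduced v -> reduced (foldr push v u).
Proof. by move=> rv; elim: u => //= a u; exact: push_reduced. Qed.

Lemma reduce_reduced w : reduced (reduce w).
Proof. exact: foldr_push_reduced. Qed.

Lemma reduce_id w : reduced w -> reduce w = w.
Proof.
elim: w => //= a w IH raw; rewrite /reduce /= -/(reduce w).
rewrite IH ?(reduced_behead raw)//.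
by case: w raw {IH} => //= b w /andP[/negbTE->].
Qed.

Lemma pushK a w : reduced w -> push (letter_inv a) (push a w) = w.
Proof.
case: w => [|b w] /=; first by rewrite letter_invK eqxx.
case: eqP => [-> {b}|_ _] /=; last by rewrite letter_invK eqxx.
by case: w => //= c w /andP[/negbTE]; rewrite letter_invK => ->.
Qed.

Lemma push_foldr a w v : reduced v ->
  foldr push v (push a w) = push a (foldr push v w).
Proof.
move=> rv; case: w => //= b w; case: eqP => [->|//] /=.
by rewrite -{1}[a]letter_invK pushK // foldr_push_reduced.
Qed.

Lemma foldr_push_reduce u v : reduced v ->
  foldr push v (reduce u) = foldr push v u.
Proof.
move=> rv; elim: u => //= a u IH.
by rewrite /reduce /= -/(reduce u) push_foldr // IH.
Qed.

Lemma reduce_cat u v : reduce (u ++ v) = foldr push (reduce v) u.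
Proof. by rewrite /reduce foldr_cat. Qed.

Definition word_inv w := rev (map letter_inv w).

Lemma word_invK : involutive word_inv.
Proof. by move=> w; rewrite /word_inv map_rev revK mapK //; exact: letter_invK. Qed.

Lemma foldr_push_inv u v : reduced v ->
  foldr push (foldr push v u) (word_inv u) = v.
Proof.
move=> rv; elim: u => //= a u IH.
by rewrite /word_inv /= rev_cons foldr_rcons pushK ?IH // foldr_push_reduced.
Qed.

End ReducedWords.

Record freeGroup (X : choiceType) :=
  FreeGroup { fgword :> seq (X * bool); _ : reduced fgword }.

HB.instance Definition _ (X : choiceType) := [isSub for @fgword X].
HB.instance Definition _ (X : choiceType) := [Choice of freeGroup X by <:].

Section FreeGroup.
Context {X : choiceType}.
Implicit Types u v w : freeGroup X.

Lemma fgword_reduced w : reduced w.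
Proof. by case: w. Qed.

Definition fg_of_word (s : seq (X * bool)) : freeGroup X :=
  FreeGroup (reduce_reduced s).

Definition fg_one : freeGroup X := fg_of_word [::].
Definition fg_mul u v := fg_of_word (fgword u ++ fgword v).
Definition fg_inv u := fg_of_word (word_inv u).
Definition fg_gen (x : X) := fg_of_word [:: (x, false)].

Lemma fg_mulA : associative fg_mul.
Proof.
move=> u v w; apply/val_inj; rewrite /=.
have rw := reduce_reduced w.
rewrite [RHS]reduce_cat foldr_push_reduce // reduce_cat foldr_cat.
by rewrite reduce_cat (reduce_id (foldr_push_reduced _ rw)).
Qed.

Lemma fg_mul1g : left_id fg_one fg_mul.
Proof. by move=> u; apply/val_inj; rewrite /= reduce_id ?fgword_reduced. Qed.

Lemma fg_mulg1 : right_id fg_one fg_mul.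
Proof. by move=> u; apply/val_inj; rewrite /= cats0 reduce_id ?fgword_reduced. Qed.

Lemma fg_mulVg : left_inverse fg_one fg_inv fg_mul.
Proof.
move=> u; apply/val_inj; rewrite /= reduce_cat foldr_push_reduce ?reduce_reduced//.
by rewrite foldr_push_inv.
Qed.

Lemma fg_mulgV : right_inverse fg_one fg_inv fg_mul.
Proof.
move=> u; apply/val_inj; rewrite /= reduce_cat (reduce_id (reduce_reduced _)).
by have := @foldr_push_inv _ (word_inv u) [::] isT; rewrite word_invK.
Qed.

HB.instance Definition _ := isGroup.Build (freeGroup X)
  fg_mulA fg_mul1g fg_mulg1 fg_mulVg fg_mulgV.

End FreeGroup.

Section FreeGroupUniversal.
Context {X : choiceType} {H : groupType} (f : X -> H).
Local Open Scope group_scope.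

Let letter_val (a : X * bool) : H := if a.2 then (f a.1)^-1 else f a.1.
Let word_val (s : seq (X * bool)) : H := foldr (fun a h => letter_val a * h) 1 s.

Let letter_valV a : letter_val (letter_inv a) = (letter_val a)^-1.
Proof. by case: a => x [] /=; rewrite /letter_val /= ?invgK. Qed.

Let word_val_push a s : word_val (push a s) = letter_val a * word_val s.
Proof.
case: s => //= b s; case: eqP => [->|//].
by rewrite letter_valV mulgA mulgV mul1g.
Qed.

Let word_val_foldr s t : word_val (foldr push t s) =
  foldr (fun a h => letter_val a * h) (word_val t) s.
Proof. by elim: s => //= a s IH; rewrite word_val_push IH. Qed.

Let word_val_reduce s : word_val (reduce s) = word_val s.
Proof. exact: word_val_foldr. Qed.

Let word_val_cat s t : word_val (s ++ t) = word_val s * word_val t.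
Proof. by elim: s => [|a s IH] /=; rewrite ?mul1g // IH mulgA. Qed.

Lemma fg_word_gen (w : freeGroup X) : exists s : seq (X * bool),
  w = foldr (fun a (h : freeGroup X) =>
    (if a.2 then (fg_gen a.1)^-1 else fg_gen a.1) * h) 1 s.
Proof.
case: w => s rs; exists s.
elim: s rs => [|a s IH] rs /=; first exact/val_inj.
rewrite -(IH (reduced_behead rs)); apply/val_inj => /=.
have -> : fgword (if a.2 then (fg_gen a.1)^-1 else fg_gen a.1) = [:: a].
  by case: a {rs IH} => x [].
by rewrite [LHS](esym (reduce_id rs)).
Qed.

Theorem freeGroup_universal : exists! phi : freeGroup X -> H,
  {morph phi : u v / u * v} /\ forall x, phi (fg_gen x) = f x.
Proof.
exists (fun w => word_val w); split; first split.
- by move=> u v; rewrite /= word_val_reduce word_val_cat.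
- by move=> x; rewrite /= mulg1.
move=> psi [psiM psig].
have psi1 : psi 1 = 1 by apply: (mulgI (psi 1)); rewrite -psiM !mulg1.
have psiV u : psi u^-1 = (psi u)^-1.
  by apply: (mulgI (psi u)); rewrite -psiM !mulgV.
apply/funext => w; have [s ->] := fg_word_gen w.
elim: s => [|a s IH] /=; first by rewrite psi1.
rewrite psiM -IH /= word_val_reduce word_val_cat; congr (_ * _).
by case: a => x []; rewrite /= ?psiV psig /= mulg1.
Qed.

End FreeGroupUniversal.

Definition F2 := freeGroup 'I_2.

Lemma F2_infinite : infinite_set [set: F2].
Proof.
move=> /(finite_image (fun w : F2 => size w)) finsz; apply: infinite_nat.
apply: sub_finite_set finsz => n _.
have rn : reduced (nseq n (@ord0 1, false)).
  rewrite /reduced; case: n => //= n; by elim: n.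
by exists (FreeGroup rn); rewrite // size_nseq.
Qed.

Section WordMetric.
Context {G : groupType} (S : set G).

Definition word_in (w : seq G) :=
  forall s, s \in w -> S s \/ S (s^-1)%g.

Definition generates :=
  forall g, exists2 w, word_in w & (\prod_(s <- w) s)%g = g.

Definition has_word (g : G) (n : nat) :=
  exists w, [/\ size w = n, word_in w & (\prod_(s <- w) s)%g = g].

(** The default value [0] is only used for [g] outside the subgroup generated
    by [S]. *)
Definition word_length (g : G) : nat :=
  xget 0 [set n | has_word g n /\ forall m, has_word g m -> (n <= m)%N].

Definition word_dist (x y : G) : nat := word_length (x^-1 * y)%g.

Lemma word_lengthP : generates -> forall g, has_word g (word_length g) /\
  forall m, has_word g m -> (word_length g <= m)%N.
Proof.
move=> gen g; rewrite /word_length; case: xgetP => [n _ //|noword].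
have exn : exists n, `[< has_word g n >].
  by have [w Sw pw] := gen g; exists (size w); apply/asboolP; exists w.
case: (ex_minnP exn) => n /asboolP hn minn; case: (noword n); split => // m hm.
by apply: minn; apply/asboolP.
Qed.

Lemma word_dist_mull (g x y : G) :
  word_dist (g * x)%g (g * y)%g = word_dist x y.
Proof. by rewrite /word_dist invgM -mulgA mulKg. Qed.

End WordMetric.

Section Higson.
Context {T : Type} (d : T -> T -> nat).

Definition controlled (E : set (T * T)) :=
  exists M : nat, forall x y, E (x, y) -> (d x y <= M)%N.

Definition cobord (V : zmodType) (f : T -> V) (x y : T) : V := f y - f x.

(** The bounded sets are the finite ones, which is right when [d] is the word
    metric of a finite generating set. In the order of [R[i]], [0 < eps] says
    that [eps] is a positive real, and [`|z|] is the modulus of [z]. *)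
Definition is_higson (R : realType) (f : T -> R[i]) :=
  (exists M, forall x, `|f x| <= M) /\
  forall E, controlled E -> forall eps : R[i], 0 < eps ->
    exists2 B : set T, finite_set B &
      forall x y, E (x, y) -> ~ (B `*` B) (x, y) -> `|cobord f x y| < eps.

End Higson.


Lemma ptws_cvgP {I : Type} {V : topologicalType} (F : set_system {ptws I -> V})
    (p : {ptws I -> V}) : Filter F ->
  F --> p <-> forall i, (fun q : {ptws I -> V} => q i) @ F --> p i.
Proof.
move=> FF; rewrite cvg_sup; split=> Fp i A.
  rewrite nbhsE => -[B [oB Bp] BA]; apply: (filterS (fun _ => BA _)) => /=.
  apply: (Fp i); exists ((fun q : {ptws I -> V} => q i) @^-1` B); split => //.
  by exists B.
by case=> _ [[B oB <-] Bp BA]; apply: (filterS BA); apply: Fp;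
  apply: open_nbhs_nbhs.
Qed.

Lemma ptws_continuous {I : Type} {V : topologicalType} (i : I) :
  continuous (fun q : {ptws I -> V} => q i).
Proof. by move=> p; exact: (ptws_cvgP p (nbhs_filter p)).1. Qed.

Lemma ptws_reindex_continuous {I J : Type} {V : topologicalType} (s : J -> I) :
  continuous (fun q : {ptws I -> V} => (fun j => q (s j)) : {ptws J -> V}).
Proof.
move=> p; apply: (proj2 (ptws_cvgP _ (fmap_filter _ (nbhs_filter p)))) => j.
exact: (@ptws_continuous I V (s j) p).
Qed.

Lemma set_type_cvgP {V : topologicalType} (D : set V) (F : set_system D) (p : D) :
  Filter F -> F --> p <-> set_val @ F --> set_val p.
Proof.
move=> FF; split=> Fp A.
  rewrite nbhsE => -[B [oB Bp] BA]; apply: (filterS (fun _ => BA _)) => /=.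
  by apply: Fp; exists (set_val @^-1` B); split => //; exists B.
case=> _ [[B oB <-] Bp BA]; apply: (filterS BA); apply: Fp.
exact: open_nbhs_nbhs.
Qed.

Section Subspace.
Context {I : Type} {V : topologicalType} (D : set {ptws I -> V}).
Implicit Types x : D.

Lemma sub_ptws_cvgP (F : set_system D) x : Filter F ->
  F --> x <-> forall i, (fun y : D => set_val y i) @ F --> set_val x i.
Proof.
move=> FF; apply: iff_trans (set_type_cvgP x FF) _.
exact: (ptws_cvgP _ (fmap_filter _ FF)).
Qed.

Lemma sub_ptws_continuous i : continuous (fun y : D => set_val y i).
Proof. by move=> x; exact: (proj1 (sub_ptws_cvgP x (nbhs_filter x))). Qed.

Lemma sub_ptws_hausdorff : hausdorff_space V -> hausdorff_space D.
Proof.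
move=> HV x y xy; apply/val_inj/funext => i; apply: HV => A B.
move=> /(@sub_ptws_continuous i) nA /(@sub_ptws_continuous i) nB.
by have [z [Az Bz]] := xy _ _ nA nB; exists (set_val z i).
Qed.

Lemma sub_ptws_compact (K : I -> set V) : closed D -> (forall i, compact (K i)) ->
  (forall p, D p -> forall i, K i (p i)) -> compact [set: D].
Proof.
move=> cD cK DK.
have : compact D.
  apply: subclosed_compact cD (@tychonoff {classic I} (fun=> V) K cK) _.
  by move=> p /DK.
move=> cptD F FF _.
have [|p [Dp clp]] := cptD (set_val @ F) (fmap_proper_filter _ FF).
  by apply: (@filterS _ F _ setT) filterT => x _; exact: (set_valP x).
exists (exist (fun q => q \in D) p (mem_set Dp)); split => // A N FA.
case=> _ [[B oB <-] Bp BN].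
have [|_ [[x Ax <-] Bx]] := clp (set_val @` A) B _ (open_nbhs_nbhs (conj oB Bp)).
  by apply: (@filterS _ F _ A) FA => x Ax; exists x.
by exists x; split => //; exact: BN.
Qed.

End Subspace.

Lemma ultra_fmap_cvg {T : Type} {K : topologicalType} (f : T -> K)
  (U : set_system T) : compact [set: K] -> UltraFilter U ->
  exists p : K, f @ U --> p.
Proof.
move=> cK UU; have [|p [_ clp]] := cK (f @ U) _ _; first exact: filterT.
exists p => N nN; case: (in_ultra_setVsetC (f @^-1` N) UU) => // UN.
have [|_ [[t nNt <-] Nft]] := clp (f @` (~` (f @^-1` N))) N _ nN => //.
by apply: (@filterS _ U _ (~` (f @^-1` N))) UN => t ?; exists t.
Qed.

Lemma cvg_sub_near {K : numFieldType} {T : Type} {U : set_system T}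
    {u v : T -> K^o} {a b : K^o} {e : K} : UltraFilter U -> 0 < e ->
    u @ U --> a -> v @ U --> b -> U [set t | `|(v t - u t) - (b - a)| < e].
Proof.
move=> UU e0 ua vb; have : (v \- u) @ U --> b - a by exact: cvgB.
move=> /cvgrPdist_lt/(_ _ e0).
by apply: filterS => t; rewrite distrC.
Qed.

Section ComplexTopology.
Context {R : realType}.
Local Notation C := R[i]^o.

Let cplx (z : R * R) : C := (complex.Complex z.1 z.2).

Let norm_real (a : R) : `|a%:C%C| = `|a|%:C%C.
Proof. by rewrite normc_def /= expr0n addr0 sqrtr_sqr. Qed.

Let norm_cplx (a b : R) : `|complex.Complex a b| <= (`|a| + `|b|)%:C%C.
Proof.
have -> : complex.Complex a b = a%:C%C + 'i%C * b%:C%C.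
  by simpc; congr (complex.Complex _ _); rewrite ?addr0.
rewrite (le_trans (ler_normD _ _))// normrM rmorphD /= !norm_real lerD2l.
by rewrite normc_def /= expr0n expr1n add0r sqrtr1 mul1r.
Qed.

Let cplx_continuous : continuous cplx.
Proof.
move=> z; apply/cvgrPdist_lt => /= e; rewrite ltcE /= => /andP[/eqP ime ree].
have e2 : 0 < complex.Re e / 2 by rewrite divr_gt0.
have /cvgrPdist_lt/(_ _ e2) z1 : fst @ z --> z.1 by exact: cvg_fst.
have /cvgrPdist_lt/(_ _ e2) z2 : snd @ z --> z.2 by exact: cvg_snd.
apply: filterS (filterI z1 z2) => w [/= w1 w2].
apply: le_lt_trans (_ : (`|z.1 - w.1| + `|z.2 - w.2|)%:C%C < _).
  exact: norm_cplx.
by rewrite ltcE /= -ime eqxx /= [complex.Re e]splitr ltrD.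
Qed.

Lemma disc_compact (M : R[i]) : exists2 K : set C,
  compact K & forall z : R[i], `|z| <= M -> K z.
Proof.
pose I := `[- complex.Re M, complex.Re M]%classic : set R.
have sq : compact (I `*` I) by apply: compact_setX; apply: segment_compact.
exists (cplx @` (I `*` I)).
  by apply: continuous_compact => //; apply: continuous_subspaceT.
move=> [a b]; rewrite normc_def /= lecE /= => /andP[_ abM].
exists (a, b) => //; split; rewrite /I /= in_itv /= -ler_norml;
  by rewrite (le_trans _ abM)// -sqrtr_sqr ler_wsqrtr // ?lerDl ?lerDr sqr_ge0.
Qed.

Lemma compact_normc_bounded (K : set C) : compact K ->
  exists M : R[i], forall z, K z -> `|z : R[i]| <= M.
Proof.
move=> cK; pose nm (z : C) : R := complex.Re `|z : R[i]|.
have nmE (z : C) : (nm z)%:C%C = `|z : R[i]| by rewrite /nm normc_def.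
have nm_continuous : continuous nm.
  move=> z; apply: (proj2 (@cvgrPdist_lt _ _ _ _ (nbhs_filter z) nm (nm z))) => e e0.
  have e0C : 0 < e%:C%C by rewrite ltcR.
  have zz : (id : C -> C) @ nbhs z --> z by exact: cvg_id.
  have zz' := proj1 (@cvgrPdist_lt _ _ _ _ (nbhs_filter z) id z) zz _ e0C.
  apply: (@filterS _ (nbhs z) _ _ _ _ zz') => w zw; rewrite -ltcR (le_lt_trans _ zw)//.
  by rewrite -norm_real rmorphB /= !nmE ler_dist_dist.
have : compact (nm @` K).
  by apply: continuous_compact => //; apply: continuous_subspaceT.
move=> /compact_bounded[M [_ MK]]; exists (M + 1)%:C%C => z Kz.
rewrite -nmE lecR (le_trans (ler_norm _))//.
by apply: (MK (M + 1)); [rewrite ltrDl|exists z].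
Qed.

End ComplexTopology.

Section HigsonCompactification.
Context {G : groupType} (R : realType) (S : set G).

Definition higson := {f : G -> R[i] | is_higson (word_dist S) f}.
Definition higson_fun (f : higson) : G -> R[i] := sval f.
Coercion higson_fun : higson >-> Funclass.

(** The Higson compactification is the closure of the image of [G] under the
    evaluation map into the product of copies of the complex plane indexed by
    the Higson functions. Below, [hcompact_compact], [hcompact_hausdorff],
    [hincl_dense], [hincl_inj] and [hincl_open] say that it is a
    compactification of the discrete space [G], [higson_extends] and
    [continuous_higson] that the restrictions to [G] of its continuous
    functions are exactly the Higson functions. *)
Definition higson_space : topologicalType := {ptws higson -> R[i]^o}.
Definition higson_eval (h : G) : higson_space := fun f => f h.
Definition hcompact : set higson_space := closure (range higson_eval).

Definition hval (x : hcompact) : higson -> R[i] := set_val x.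

Lemma hincl_subproof h : higson_eval h \in hcompact.
Proof. by apply/mem_set/subset_closure; exists h. Qed.

Definition hincl (h : G) : hcompact :=
  exist (fun x => x \in hcompact) _ (hincl_subproof h).

Definition hcorona : set hcompact := ~` range hincl.

Lemma pullback_subproof (g : G) (f : higson) :
  is_higson (word_dist S) (fun h => f (g * h)%g).
Proof.
case: f => f [[M fM] fH]; split; first by exists M => x; exact: fM.
move=> E [N EN] eps eps0.
have [|B finB fB] := fH [set (g * xy.1, g * xy.2)%g | xy in E] _ eps eps0.
  by exists N => _ _ [[x y] /EN dN [<- <-]]; rewrite word_dist_mull.
exists [set (g^-1 * b)%g | b in B]; first exact: finite_image.
move=> x y Exy nB; apply: fB; first by exists (x, y).
by move=> [/= Bx By]; apply: nB; split;
  [exists (g * x)%g|exists (g * y)%g]; rewrite //= mulKg.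
Qed.

Definition pullback (g : G) (f : higson) : higson :=
  exist _ _ (pullback_subproof g f).

Definition hshift (g : G) (p : higson_space) : higson_space :=
  fun f => p (pullback g f).

Lemma hshift_eval g h : hshift g (higson_eval h) = higson_eval (g * h)%g.
Proof. by []. Qed.

Lemma hshift_continuous g : continuous (hshift g).
Proof. exact: (@ptws_reindex_continuous _ _ R[i]^o (pullback g)). Qed.

Lemma hshift_subproof g (x : hcompact) : hshift g (set_val x) \in hcompact.
Proof.
apply/mem_set => A nA.
have [_ [[h _ <-] Ah]] := set_valP x _ (hshift_continuous nA).
by exists (higson_eval (g * h)%g); split => //; exists (g * h)%g.
Qed.

(** The continuous extension of the left translation by [g]: a Higson function
    [f], as a coordinate, is pulled back to [h |-> f (g * h)]. *)
Definition htrans (g : G) (x : hcompact) : hcompact :=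
  exist (fun x => x \in hcompact) _ (hshift_subproof g x).

Lemma hval_incl h f : hval (hincl h) f = f h.
Proof. by []. Qed.

Lemma hval_trans g x f : hval (htrans g x) f = hval x (pullback g f).
Proof. by []. Qed.

Lemma hval_inj : injective hval.
Proof. by move=> x y xy; apply/val_inj. Qed.

Lemma htrans_incl g h : htrans g (hincl h) = hincl (g * h)%g.
Proof. exact/val_inj. Qed.

Lemma htransM g g' x : htrans (g * g')%g x = htrans g (htrans g' x).
Proof.
apply/hval_inj/funext => f; rewrite !hval_trans; congr (hval x _).
by apply/eq_sig_hprop => /=; [move=> ? ? ?; exact: Prop_irrelevance|];
  apply/funext => h /=; rewrite mulgA.
Qed.

Lemma htrans1 x : htrans 1%g x = x.
Proof.
apply/hval_inj/funext => f; rewrite !hval_trans; congr (hval x _).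
by apply/eq_sig_hprop => /=; [move=> ? ? ?; exact: Prop_irrelevance|];
  apply/funext => h /=; rewrite mul1g.
Qed.

Lemma hcorona_subproof g (x : hcorona) : htrans g (set_val x) \in hcorona.
Proof.
apply/mem_set => -[h _ hx]; apply: (set_valP x).
by exists (g^-1 * h)%g; rewrite // -htrans_incl hx -htransM mulVg htrans1.
Qed.

Definition corona_act (g : G) (x : hcorona) : hcorona :=
  exist (fun x => x \in hcorona) _ (hcorona_subproof g x).

Lemma hval_continuous f : continuous (hval^~ f : hcompact -> R[i]^o).
Proof. exact: (@sub_ptws_continuous higson R[i]^o hcompact f). Qed.

Lemma hcompact_compact : compact [set: hcompact].
Proof.
have bdK (f : higson) : exists K : set R[i]^o, compact K /\ forall h, K (f h).
  have [[M fM] _] := svalP f; have [K cK KM] := disc_compact M.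
  by exists K; split => // h; exact: KM.
have [K Kf] := choice bdK.
apply: (@sub_ptws_compact higson R[i]^o hcompact K); first exact: closed_closure.
  by move=> f; have [] := Kf f.
move=> p Dp f; have [cK KM] := Kf f.
have /closure_id -> : closed (K f) by apply: compact_closed => //; exact: norm_hausdorff.
move=> A /(@ptws_continuous higson R[i]^o f p) nA.
by have [_ [[h _ <-] Ah]] := Dp _ nA; exists (f h).
Qed.

Lemma hcompact_hausdorff : hausdorff_space hcompact.
Proof.
apply: (@sub_ptws_hausdorff higson R[i]^o hcompact).
exact: norm_hausdorff.
Qed.

Lemma hincl_dense : closure (range hincl) = [set: hcompact].
Proof.
apply/seteqP; split=> // x _ N [_ [[B oB <-] Bx BN]].
have [_ [[h _ <-] Bh]] := set_valP x _ (open_nbhs_nbhs (conj oB Bx)).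
by exists (hincl h); split; [exists h|exact: BN].
Qed.

Lemma hcompact_cvgP (F : set_system hcompact) (x : hcompact) : Filter F ->
  F --> x <-> forall f, hval^~ f @ F --> (hval x f : R[i]^o).
Proof. exact: (@sub_ptws_cvgP higson R[i]^o hcompact F x). Qed.

Lemma htrans_continuous g : continuous (htrans g).
Proof.
move=> x; apply: (proj2 (hcompact_cvgP _ (fmap_filter _ (nbhs_filter x)))) => f.
exact: (@hval_continuous (pullback g f) x).
Qed.

Lemma corona_act_continuous g : continuous (corona_act g).
Proof.
move=> x; apply: (proj2 (set_type_cvgP _ (fmap_filter _ (nbhs_filter x)))).
apply: (@continuous_comp _ _ _ (set_val : hcorona -> hcompact) (htrans g)).
  exact: (proj1 (set_type_cvgP _ (nbhs_filter x))).
exact: htrans_continuous.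
Qed.

Lemma corona_actM g g' x :
  corona_act (g * g')%g x = corona_act g (corona_act g' x).
Proof. by apply/val_inj; exact: htransM. Qed.

Lemma corona_act1 x : corona_act 1%g x = x.
Proof. by apply/val_inj; exact: htrans1. Qed.

(** Restriction to [G] identifies the continuous functions on the
    compactification with the Higson functions. *)

Theorem higson_extends (f : G -> R[i]) : is_higson (word_dist S) f ->
  exists2 phi : hcompact -> R[i]^o,
    continuous phi & forall h, phi (hincl h) = f h.
Proof. by move=> Hf; exists (hval^~ (exist _ f Hf)); first exact: hval_continuous. Qed.

Theorem continuous_higson (phi : hcompact -> R[i]^o) : continuous phi ->
  is_higson (word_dist S) (fun h => phi (hincl h)).
Proof.
move=> cphi; split.
  have [|M phiM] := @compact_normc_bounded R (phi @` setT).
    apply: continuous_compact; last exact: hcompact_compact.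
    exact: continuous_subspaceT.
  by exists M => h; apply: phiM; exists (hincl h).
move=> E ctrlE eps eps0; apply: contrapT => noB.
pose bad (B : set G) := [set xy : G * G | [/\ E xy, ~ (B `*` B) xy &
  ~ `|cobord (fun h => phi (hincl h) : R[i]) xy.1 xy.2| < eps]].
pose F := filter_from (@finite_set G) bad.
have PF : ProperFilter F.
  apply: filter_from_proper; last first.
    move=> B finB; apply: contrapT => nobad; apply: noB; exists B => // x y Exy nB.
    by apply: contrapT => ge; apply: nobad; exists (x, y).
  apply: filter_from_filter; first by exists set0; exact: finite_set0.
  move=> A B finA finB; exists (A `|` B); first by rewrite finite_setU.
  by move=> -[x y] [Exy nAB ge]; split; split => // -[/= Bx By]; apply: nAB;
    split; [left|left|right|right].
have [U [UU FU]] := ultraFilterLemma PF.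
have [p Up] := ultra_fmap_cvg (fun xy => hincl xy.1) hcompact_compact UU.
have [q Uq] := ultra_fmap_cvg (fun xy => hincl xy.2) hcompact_compact UU.
have pq : p = q.
  apply: hval_inj; apply/funext => f; apply/esym/eqP; rewrite -subr_eq0.
  rewrite -normr_le0; apply/ler_addgt0Pr => e e0; rewrite add0r.
  have e2 : 0 < e / 2 by rewrite divr_gt0.
  have Upf : (fun xy => hval (hincl xy.1) f) @ U --> (hval p f : R[i]^o).
    exact: (cvg_comp _ _ Up (@hval_continuous f p)).
  have Uqf : (fun xy => hval (hincl xy.2) f) @ U --> (hval q f : R[i]^o).
    exact: (cvg_comp _ _ Uq (@hval_continuous f q)).
  have U1 := cvg_sub_near UU e2 Upf Uqf.
  have [_ fH] := svalP f; have [B finB fB] := fH E ctrlE _ e2.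
  have UB : U (bad B) by apply: FU; exists B.
  have [[x y] [/= xye [Exy nB _]]] := filter_ex (filterI U1 UB).
  have := fB x y Exy nB; rewrite /cobord => xye'.
  rewrite -[hval q f - hval p f](subKr (f y - f x)) [e]splitr.
  by rewrite (le_trans (ler_normB _ _))// lerD // ltW.
have Uphip : (fun xy => phi (hincl xy.1)) @ U --> (phi p : R[i]^o).
  exact: (cvg_comp _ _ Up (cphi p)).
have Uphiq : (fun xy => phi (hincl xy.2)) @ U --> (phi q : R[i]^o).
  exact: (cvg_comp _ _ Uq (cphi q)).
have U1 := cvg_sub_near UU eps0 Uphip Uphiq.
have UB : U (bad set0) by apply: FU; exists set0 => //; exact: finite_set0.
have [[x y] [/= + [_ _ ge]]] := filter_ex (filterI U1 UB).
by rewrite pq subrr subr0.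
Qed.

(** For a finite generating set, [hincl] embeds [G] as a discrete open subset. *)

Lemma has_word_finite n : finite_set S -> finite_set [set g | has_word S g n].
Proof.
move=> finS; have finA : finite_set (S `|` [set s^-1%g | s in S]).
  by rewrite finite_setU; split=> //; exact: finite_image.
elim: n => [|n IH].
  apply: (@sub_finite_set _ _ [set 1%g]) => // g [w [/size0nil -> _ <-]].
  by rewrite big_nil.
apply: (sub_finite_set _ (finite_image2 (fun x y : G => (x * y)%g) finA IH)).
move=> g [[|s w] [//= [sw] Sw <-]]; exists s.
  have [|Ss] := Sw s (mem_head _ _); [by left|right].
  by exists s^-1%g; rewrite ?invgK.
exists (\prod_(t <- w) t)%g; last by rewrite big_cons.
by exists w; split => // t tw; apply: Sw; rewrite inE tw orbT.
Qed.

Lemma ball_finite (M : nat) : finite_set S -> generates S ->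
  finite_set [set g | (word_length S g <= M)%N].
Proof.
move=> finS genS.
apply: (@sub_finite_set _ _ (\bigcup_(n in `I_M.+1) [set g | has_word S g n])).
  by move=> g /= gM; exists (word_length S g) => //; case: (word_lengthP genS g).
by apply: bigcup_finite => // n _; exact: has_word_finite.
Qed.

Definition dirac_fun (g h : G) : R[i] := (h == g)%:R.

Lemma dirac_higson g : finite_set S -> generates S ->
  is_higson (word_dist S) (dirac_fun g).
Proof.
move=> finS genS; split.
  by exists 1 => h; rewrite /dirac_fun; case: eqP; rewrite ?normr1 ?normr0 ?ler01.
move=> E [M EM] eps eps0; have finB := ball_finite M finS genS.
exists ([set g] `|` ([set (g * b)%g | b in [set b | (word_length S b <= M)%N]] `|`
   [set (g * b^-1)%g | b in [set b | (word_length S b <= M)%N]])).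
  by rewrite !finite_setU; split=> //; split; exact: finite_image.
move=> x y /EM; rewrite /word_dist => xyM nB.
rewrite /cobord /dirac_fun; have [xg|_] := eqVneq x g.
  case: nB; split; [by left|right; left]; exists (x^-1 * y)%g => //=.
  by rewrite -xg mulVKg.
have [yg|_] := eqVneq y g; last by rewrite subrr normr0.
case: nB; split; [right; right|by left]; exists (x^-1 * y)%g => //=.
by rewrite -yg invgM invgK mulVKg.
Qed.

Lemma hincl_inj : finite_set S -> generates S -> injective hincl.
Proof.
move=> finS genS g h gh; apply/eqP.
pose f : higson := exist _ _ (dirac_higson h finS genS).
have : hval (hincl g) f = hval (hincl h) f by rewrite gh.
rewrite !hval_incl /= /dirac_fun eqxx.
by case: eqP => // _ /esym/eqP; rewrite oner_eq0.
Qed.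

Lemma hincl_open g : finite_set S -> generates S -> open [set hincl g].
Proof.
move=> finS genS; pose f : higson := exist _ _ (dirac_higson g finS genS).
pose O : set hcompact := (hval^~ f) @^-1` (~` [set (0 : R[i]^o)]).
have oO : open O.
  apply: open_comp; first by move=> x _; exact: hval_continuous.
  by apply: closed_openC; apply: compact_closed (@compact_set1 _ _); exact: norm_hausdorff.
suff -> : [set hincl g] = O by [].
apply/seteqP; split=> [_ ->|x Ox].
  by rewrite /O /= hval_incl /= /dirac_fun eqxx; exact/eqP/oner_neq0.
apply: hcompact_hausdorff => A B nA /nbhs_singleton Bg.
have [_ [[h _ <-] [Ah Oh]]] : (range hincl `&` (A `&` O)) !=set0.
  have : closure (range hincl) x by rewrite hincl_dense.
  by apply; apply: filterI => //; exact: open_nbhs_nbhs.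
exists (hincl h); split=> //.
suff -> : h = g by [].
by apply/eqP; move: Oh; rewrite /O /= hval_incl /= /dirac_fun; case: eqP.
Qed.

Lemma hcorona_nonempty : finite_set S -> generates S ->
  infinite_set [set: G] -> hcorona !=set0.
Proof.
move=> finS genS infG; apply: contrapT => noc.
pose F := filter_from (@finite_set G) (fun B => ~` B).
have PF : ProperFilter F.
  apply: filter_from_proper; last first.
    move=> B finB; apply/set0P/eqP => /(congr1 (@setC G)).
    by rewrite setCK setC0 => BT; apply: infG; rewrite -BT.
  apply: filter_from_filter; first by exists set0; exact: finite_set0.
  by move=> A B finA finB; exists (A `|` B); [rewrite finite_setU|rewrite setCU].
have [|x [_ clx]] := hcompact_compact (fmap_proper_filter hincl PF).
  exact: filterT.
have [g _ gx] : range hincl x by apply: contrapT => nx; apply: noc; exists x.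
have Fg : F (~` [set g]) by exists [set g] => //; exact: finite_set1.
have [||_ [[h hg <-] /= hgi]] := clx (hincl @` (~` [set g])) [set hincl g].
- by apply: (@filterS _ F _ (~` [set g])) Fg => h ?; exists h.
- by rewrite -gx; apply: open_nbhs_nbhs; split => //; exact: hincl_open.
- exact: hg (hincl_inj finS genS hgi).
Qed.

End HigsonCompactification.

Arguments higson {G} R S.
Arguments higson_space {G} R S.
Arguments hcompact {G} R S.
Arguments hcorona {G} R S.
Arguments hincl {G R S} h.
Arguments htrans {G R S} g x.
Arguments corona_act {G R S} g x.

(* Main.v *)
Require Import Defs.
From HB Require Import structures.
From mathcomp Require Import all_boot all_order all_algebra.
From mathcomp Require Import complex.
From mathcomp Require Import boolp classical_sets functions cardinality.
From mathcomp Require Import reals topology normedtype.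

(** Whether a reduced word starts with a given letter [a] is, up to finitely
    many exceptions, unchanged by right multiplication, so the indicator [f_a]
    is a Higson function. As [a * h] starts with [a] iff [h] does not start with
    [a^-1], a fixed point identifies [f_a] with [1 - f_{a^-1}] as coordinates:
    elements [h] of the group near the fixed point start with [a] or [a^-1].
    This cannot hold for two different generators at once. *)

Set Implicit Arguments.
Unset Strict Implicit.
Unset Printing Implicit Defensive.

Import Order.TTheory GRing.Theory Num.Theory.
Import numFieldNormedType.Exports.

Local Open Scope classical_set_scope.
Local Open Scope ring_scope.

Section HigsonOfRightAlmostInvariant.
Context {G : groupType} {R : realType}.
Implicit Types (S : set G) (f : G -> R[i]).

Definition right_variation f (g : G) : set G := [set x | f (x * g)%g <> f x].

(** If [f] changes from [x] to [x * g * h], it changes at the first step or at the second. With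
    [right_variationV], this reduces finiteness to generators. *)
Lemma right_variationM f g h :
  finite_set (right_variation f g) -> finite_set (right_variation f h) ->
  finite_set (right_variation f (g * h)%g).
Proof.
move=> fing finh.
apply: (@sub_finite_set _ _ (right_variation f g `|`
    [set (x * g^-1)%g | x in right_variation f h])); last first.
  by rewrite finite_setU; split=> //; exact: finite_image.
move=> x; rewrite /right_variation /= mulgA => xgh.
have [xg|xg] := pselect (f (x * g)%g = f x); last by left.
by right; exists (x * g)%g; [rewrite xg|rewrite mulgK].
Qed.

Lemma right_variationV f g :
  finite_set (right_variation f g) -> finite_set (right_variation f g^-1%g).
Proof.
move=> fing.
apply: (@sub_finite_set _ _ [set (x * g)%g | x in right_variation f g]);
  last exact: finite_image.
move=> x; rewrite /right_variation /= => xg.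
by exists (x * g^-1)%g; rewrite /= mulgVK // => /esym.
Qed.

(** On a controlled set [x^-1 * y] stays in a ball, which is finite, so only finitely many right
    translations matter. *)
Lemma is_higson_right_variation S f : finite_set S -> generates S ->
  (exists M, forall x, `|f x| <= M) ->
  (forall g, finite_set (right_variation f g)) ->
  is_higson (word_dist S) f.
Proof.
move=> finS genS bf finf; split=> // E [M EM] eps eps0.
pose K := [set g | (word_length S g <= M)%N].
(* The translates put the second point [y = x * g] into the exceptional set as well: both ends of a
   bad pair must lie in it. *)
exists (\bigcup_(g in K) (right_variation f g `|`
    [set (x * g)%g | x in right_variation f g])).
  apply: bigcup_finite => [|g _]; first exact: ball_finite.
  by rewrite finite_setU; split=> //; exact: finite_image.
move=> x y /EM Kxy nB; rewrite /cobord.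
have [->|fxy] := pselect (f y = f x); first by rewrite subrr normr0.
have vx : right_variation f (x^-1 * y)%g x by rewrite /right_variation /= mulVKg.
case: nB; split; exists (x^-1 * y)%g => //; [by left|right].
by exists x; rewrite //= mulVKg.
Qed.

End HigsonOfRightAlmostInvariant.

Section FirstLetter.
Context {X : choiceType}.
Local Notation letter := (X * bool)%type.
Implicit Types (a b s : letter) (h : freeGroup X).

Definition starts_with a h : bool := ohead (fgword h) == Some a.

(** An appended letter cancels at most the last letter of a reduced word, so the first one survives
    unless it is the whole word and gets cancelled. *)
Lemma ohead_reduce_rcons b s (w : seq letter) :
  reduced (b :: w) -> b :: w <> [:: letter_inv s] ->
  ohead (reduce (rcons (b :: w) s)) = Some b.
Proof.
rewrite /reduce foldr_rcons.
elim: w b => [|c w IH] b /= => [_ bs|/andP[cb rw] _].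
  by case: eqP => // sb; case: bs; rewrite sb letter_invK.
(* Either the tail cancels completely and [b] alone remains, or the reduced tail still starts with
   [c], which does not cancel [b]. *)
have [[-> ->]|cw] := pselect (c :: w = [:: letter_inv s]).
  by rewrite /= letter_invK eqxx.
have /= := IH c rw cw.
by case: (push c _) => //= d v [->]; rewrite (negbTE cb).
Qed.

Lemma starts_with_mulr_gen a x h : h <> 1%g -> h <> (fg_gen x)^-1%g ->
  starts_with a (h * fg_gen x)%g = starts_with a h.
Proof.
move=> h1 hx; rewrite /starts_with /= cats1.
case: h h1 hx => [[|b w] rw] h1 hx /=; first by case: h1; exact/val_inj.
rewrite ohead_reduce_rcons // => bw.
by apply: hx; apply/val_inj => /=; rewrite bw.
Qed.

Lemma starts_with_mull_gen x h :
  starts_with (x, false) (fg_gen x * h)%g = ~~ starts_with (x, true) h.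
Proof.
have rh := fgword_reduced h.
rewrite /starts_with /= /reduce /= -/(reduce _) reduce_id //.
case: (fgword h) rh => [|b w] rw /=; first by rewrite eqxx.
have [bx|bx] := eqVneq b (x, true); last first.
  by rewrite !(inj_eq Some_inj) eqxx (negbTE bx).
rewrite bx eqxx /=; apply/negP => /eqP; move: rw; rewrite bx.
by case: w => //= c w /andP[cx _] [cE]; rewrite cE eqxx in cx.
Qed.

Context {R : realType}.

Definition first_letter_fun a h : R[i] := (starts_with a h)%:R.

Lemma first_letter_fun_variation a h :
  finite_set (right_variation (first_letter_fun a) h).
Proof.
have fingen x : finite_set (right_variation (first_letter_fun a) (fg_gen x)).
  apply: (@sub_finite_set _ _ ([set 1%g] `|` [set (fg_gen x)^-1%g])); last first.
    by rewrite finite_setU; split; exact: finite_set1.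
  move=> u; rewrite /right_variation /= => ux; apply: contrapT => nu.
  apply: ux; rewrite /first_letter_fun starts_with_mulr_gen // => uE;
    apply: nu; [by left|by right].
have [s ->] := fg_word_gen h.
elim: s => [|[x e] s IH] /=.
  by apply: (@sub_finite_set _ _ set0) => // u; rewrite /right_variation /= mulg1.
apply: right_variationM => //.
by case: e; rewrite //=; apply: right_variationV.
Qed.

Lemma first_letter_fun_higson (S : set (freeGroup X)) a :
  finite_set S -> generates S -> is_higson (word_dist S) (first_letter_fun a).
Proof.
move=> finS genS; apply: is_higson_right_variation => //; last first.
  exact: first_letter_fun_variation.
exists 1 => h; rewrite /first_letter_fun.
by case: starts_with; rewrite ?normr1 ?normr0 ?ler01.
Qed.

End FirstLetter.

Section FixedPoints.
Context {G : groupType} {R : realType} {S : set G}.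

(** The difference of the two coordinates is continuous and vanishes at a fixed point. *)
Lemma htrans_fixed_near (x : hcompact R S) g (f : higson R S) (e : R[i]) :
  htrans g x = x -> 0 < e ->
  nbhs x [set y : hcompact R S | `|hval y (pullback g f) - hval y f| < e].
Proof.
move=> gx e0.
have fx : hval x (pullback g f) - hval x f = 0 by rewrite -hval_trans gx subrr.
pose u (y : hcompact R S) : R[i]^o := hval y (pullback g f).
pose v (y : hcompact R S) : R[i]^o := hval y f.
have : (u \- v) @ nbhs x --> u x - v x.
  by apply: cvgB; exact: hval_continuous.
move=> /cvgrPdist_lt/(_ _ e0); apply: filterS => y.
by rewrite /u /v fx sub0r normrN.
Qed.

End FixedPoints.

Lemma htrans_gen_fixed_near {X : choiceType} {R : realType}
    {S : set (freeGroup X)} (x : hcompact R S) (i : X) :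
  finite_set S -> generates S -> htrans (fg_gen i) x = x ->
  exists2 N, nbhs x N & forall h, N (hincl h) ->
    starts_with (i, false) h || starts_with (i, true) h.
Proof.
move=> finS genS ix.
pose f : higson R S := exist _ _ (first_letter_fun_higson (i, false) finS genS).
(* At a group element both coordinates are 0 or 1. If it starts with neither letter, they are 1 and
   0, so the bound 1 excludes this case. *)
exists [set y | `|hval y (pullback (fg_gen i) f) - hval y f| < 1].
  exact: htrans_fixed_near.
move=> h; rewrite /= !hval_incl /= /first_letter_fun starts_with_mull_gen.
by case: starts_with; case: starts_with => //=; rewrite subr0 normr1 ltxx.
Qed.

Theorem proposition2p9 (R : realType) (S : set F2)
    (finS : finite_set S) (genS : generates S) :
  ~ exists x : hcorona R S, forall g : F2, corona_act g x = x.
Proof.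
move=> [x fixx].
have fixv g : htrans g (set_val x) = set_val x by rewrite -{2}(fixx g).
have [N0 nN0 N0h] := htrans_gen_fixed_near finS genS (fixv (fg_gen ord0)).
have [N1 nN1 N1h] := htrans_gen_fixed_near finS genS (fixv (fg_gen ord_max)).
(* By density some group element lies in both neighbourhoods; its first letter would then belong to
   both generators. *)
have : closure (range hincl) (set_val x) by rewrite hincl_dense.
move=> /(_ _ (filterI nN0 nN1))[_ [[h _ <-] [/N0h + /N1h]]].
by rewrite /starts_with; case: ohead => // -[j e] /orP[] /eqP[-> _].
Qed.
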